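(* Let $p_0,p\in(0,1)$, $q=1-p$, $\mathcal{Q}_S\in(0,1)$ and $\Lambda_M=1-\mathcal{Q}_S$. Let $(N_{II}(t))_{t\in\mathbb{N}_0}$ be a Bernoulli process with success probability $p_0$, and let $\Delta T$ be an independent $\mathbb{N}\cup\{\infty\}$-valued random variable with $\mathbb{P}[\Delta T=t]=\mathcal{Q}_S\,p\,q^{t-1}$ for $t\in\mathbb{N}$ and $\mathbb{P}[\Delta T=\infty]=1-\mathcal{Q}_S$. Let $M(t)=N_{II}(t)$ for $t<\Delta T$ and $M(t)=N_{II}(\Delta T)$ for $t\ge\Delta T$. Let $\vec{\xi}_1,\vec{\xi}_2,\dots$ be IID $\mathbb{Z}^d$-valued steps, independent of $M$, with finite first and second moments, and let $\vec{X}_t=(X_1(t),\dots,X_d(t))=\sum_{r=1}^{M(t)}\vec{\xi}_r$, $\vec{X}_0=\vec{0}$. Write $\xi_j$ for the $j$-th component of a generic step. (i) (Unbiased walk: diffusive behavior.) If $\mathbb{E}\,\xi_j=0$ for all $j=1,\dots,d$, then $$\lim_{t\to\infty}\frac1t\,\mathbb{E}\sum_{j=1}^d X_j(t)^2=K,\qquad K=\Lambda_M\,p_0\sum_{j=1}^d\mathbb{E}\,\xi_j^2 .$$ (ii) (Biased walk: ballistic behavior.) If $\mathbb{E}\,\xi_j\neq 0$ for some $j$, then for each such $j$, $$\mathbb{E}\,X_j(t)^2\sim \Lambda_M\,p_0^2\,(\mathbb{E}\,\xi_j)^2\,t^2\qquad (t\to\infty).$$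
   Context: $\mathbb{N}=\{1,2,\dots\}$, $\mathbb{N}_0=\{0,1,2,\dots\}$. A Bernoulli process with success probability $p_0$ is $N_{II}(t)=\sum_{r=1}^t Z_r$ with $Z_r$ IID Bernoulli$(p_0)$ and $N_{II}(0)=0$. On $\{\Delta T=\infty\}$, $M(t)=N_{II}(t)$ for all $t$. The notation $f(t)\sim g(t)$ means $f(t)/g(t)\to 1$. *)

(* Defs.v *)
From HB Require Import structures.
From mathcomp Require Import all_boot all_order all_algebra finmap.
From mathcomp Require Import all_classical all_reals all_analysis.

Set Implicit Arguments.
Unset Strict Implicit.
Unset Printing Implicit Defensive.

Import Order.TTheory GRing.Theory Num.Theory.
Import numFieldNormedType.Exports.

Local Open Scope classical_set_scope.
Local Open Scope ring_scope.

(* The countable state spaces N u {oo} (None is oo) and Z^d carry the discrete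
   sigma-algebra, as nat and bool do in the library. *)
HB.instance Definition _ := @isMeasurable.Build default_measure_display
  (option nat) discrete_measurable discrete_measurable0
  discrete_measurableC discrete_measurableU.

HB.instance Definition _ := isPointed.Build int 0.

HB.instance Definition _ (d : nat) :=
  @isMeasurable.Build default_measure_display
  'rV[int]_d discrete_measurable discrete_measurable0
  discrete_measurableC discrete_measurableU.

Section independence.
Context {R : realType} {dO : measure_display} {Omega : measurableType dO}.
Variable P : probability Omega R.

Definition mutually_independent {dU : measure_display} {U : measurableType dU}
    {I : choiceType} (X : I -> Omega -> U) : Prop :=
  forall (J : {fset I}) (B : I -> set U), (forall i, measurable (B i)) ->
    P (\bigcap_(i in [set` J]) (X i @^-1` B i)) =
    (\prod_(i <- J) P (X i @^-1` B i))%E.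

Definition identically_distributed {dU : measure_display}
    {U : measurableType dU} {I : Type} (X : I -> Omega -> U) : Prop :=
  forall i j (B : set U), measurable B -> P (X i @^-1` B) = P (X j @^-1` B).

Definition iid {dU : measure_display} {U : measurableType dU} {I : choiceType}
    (X : I -> {RV P >-> U}) : Prop :=
  mutually_independent X /\ identically_distributed X.

Definition process_sigma_algebra {dU : measure_display}
    {U : measurableType dU} {I : Type} (X : I -> Omega -> U) :
    set (set Omega) :=
  <<s \bigcup_i preimage_set_system [set: Omega] (X i) measurable >>.

(* Independence of two families of random variables as wholes; nothing is said
   about independence inside each family. *)
Definition independent_processes
    {dU : measure_display} {U : measurableType dU} {I : Type}
    {dV : measure_display} {V : measurableType dV} {J : Type}
    (X : I -> Omega -> U) (Y : J -> Omega -> V) : Prop :=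
  forall A B : set Omega,
    process_sigma_algebra X A -> process_sigma_algebra Y B ->
    P (A `&` B) = (P A * P B)%E.

End independence.

Section walk.
Context {R : realType} {dO : measure_display} {Omega : measurableType dO}.

(* Z r is the (r+1)-st trial; true counts as 1. *)
Definition bernoulli_process (P : probability Omega R) (p0 : R)
    (N : nat -> Omega -> nat) : Prop :=
  exists Z : nat -> {RV P >-> bool},
    [/\ iid Z,
        forall r, P (Z r @^-1` [set true]) = p0%:E &
        forall t w, N t w = (\sum_(r < t) Z r w)%N].

Definition stopped_process (N : nat -> Omega -> nat)
    (DT : Omega -> option nat) (t : nat) (w : Omega) : nat :=
  if DT w is Some s then (if (t < s)%N then N t w else N s w) else N t w.

(* xi r is the (r+1)-st step, so these are the first M t w steps. *)
Definition walk {d : nat} (xi : nat -> Omega -> 'rV[int]_d)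
    (M : nat -> Omega -> nat) (t : nat) (w : Omega) : 'rV[int]_d :=
  \sum_(r < M t w) xi r w.

Definition component {d : nat} (Y : Omega -> 'rV[int]_d) (j : 'I_d)
    (w : Omega) : R :=
  (Y w ord0 j)%:~R.

End walk.

Definition asymp_equiv {R : realType} (f g : nat -> \bar R) : Prop :=
  (f t / g t)%E @[t --> \oo] --> 1%E.

(* Main.v *)
From HB Require Import structures.
Require Import Defs.
From mathcomp Require Import all_boot all_order all_algebra finmap.
From mathcomp Require Import all_classical all_reals all_analysis.
From mathcomp Require Import measurable_realfun ring lra.
Import Order.TTheory GRing.Theory Num.Theory.
Import numFieldNormedType.Exports.
Local Open Scope classical_set_scope.
Local Open Scope ring_scope.

(* Independence of the steps and of M gives, for each component,
     E X_j(t)^2 = m^2 E M(t)^2 + (E xi_j^2 - m^2) E M(t),   m = E xi_j.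
   Since M(t) = sum_(r < t) Z_r 1{r < T} for T the stopping time, with Z_r the
   trials, both moments of M are sums of the survival probabilities
   h(r) = P(r < T) = Lambda_M + Q_S q^r:
     E M(t)   = p0 sum_r h(r),
     E M(t)^2 = p0^2 sum_(r, s) h(max(r, s)) + (p0 - p0^2) sum_r h(r).
   By Cesaro, sum_r h(r) ~ Lambda_M t, and Lambda_M <= h(max(r, s)) <= h(r)
   squeezes the double sum to Lambda_M t^2. *)

(** * Independence, means and the product rule *)

Section independence_facts.
Context {R : realType} {dO : measure_display} {Omega : measurableType dO}
  (P : probability Omega R).

(** The two value spaces may differ, as they must when a count in [nat] is paired with a real
    product of steps. *)
Definition independent_rvs {dU dV : measure_display} {U : measurableType dU}
    {V : measurableType dV} (X : Omega -> U) (Y : Omega -> V) : Prop :=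
  forall (A : set U) (B : set V), measurable A -> measurable B ->
    P (X @^-1` A `&` Y @^-1` B) = (P (X @^-1` A) * P (Y @^-1` B))%E.

Lemma mutually_independent_pair {dU : measure_display} {U : measurableType dU}
    {I : choiceType} (X : I -> Omega -> U) (i j : I) :
  mutually_independent P X -> i != j -> independent_rvs (X i) (X j).
Proof.
move=> indX neq_ij A B mA mB.
have := indX [fset i; j]%fset (fun k => if k == i then A else B).
rewrite big_fsetU1 ?inE//= big_seq_fset1 eqxx eq_sym (negbTE neq_ij) => <-.
  congr (P _); apply/seteqP; split => [w [Aw Bw] k /=|w /= h].
    rewrite !inE => /orP[] /eqP->; first by rewrite eqxx.
    by rewrite eq_sym (negbTE neq_ij).
  split.
    by have := h i; rewrite /= !inE !eqxx; exact.
  by have := h j; rewrite /= !inE eqxx orbT eq_sym (negbTE neq_ij); exact.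
by move=> k; case: ifP.
Qed.

Lemma independent_rvs_comp {d1 d2 d3 d4 : measure_display}
    {U : measurableType d1} {V : measurableType d2} {U' : measurableType d3}
    {V' : measurableType d4} (X : Omega -> U) (Y : Omega -> V)
    (f : U -> U') (g : V -> V') :
  measurable_fun setT f -> measurable_fun setT g ->
  independent_rvs X Y -> independent_rvs (f \o X) (g \o Y).
Proof.
move=> mf mg XY A B mA mB.
apply: (XY (f @^-1` A) (g @^-1` B)); rewrite -[X in measurable X]setTI.
  exact: mf.
exact: mg.
Qed.

(* Integrability is part of the relation because 'E_P of a non-integrable
   function is a junk value; means then add and multiply without side
   conditions. *)
Definition has_mean (f : Omega -> R) (m : R) : Prop :=
  P.-integrable [set: Omega] (EFin \o f) /\ 'E_P[f]%E = m%:E.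

Lemma has_mean_indic (A : set Omega) (a : R) :
  measurable A -> P A = a%:E -> has_mean \1_A a.
Proof.
by move=> mA PA; split; [exact: integrable_indic|rewrite expectation_indic].
Qed.

Lemma has_meanD (f g : Omega -> R) (a b : R) :
  has_mean f a -> has_mean g b -> has_mean (fun w => f w + g w) (a + b).
Proof.
move=> [fi fE] [gi gE]; split.
  by have := integrableD measurableT fi gi; apply: eq_integrable.
rewrite unlock in fE gE *.
by rewrite EFinD -fE -gE -integralD.
Qed.

Lemma has_mean_sum {I : Type} (s : seq I) (f : I -> Omega -> R)
    (m : I -> R) : (forall i, has_mean (f i) (m i)) ->
  has_mean (fun w => \sum_(i <- s) f i w) (\sum_(i <- s) m i).
Proof.
move=> fm; elim: s => [|i s IH].
  rewrite big_nil (_ : (fun _ => _) = cst 0); last first.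
    by apply/funext => w; rewrite big_nil.
  by split; [exact: integrable0|rewrite expectation_cst].
rewrite big_cons (_ : (fun _ => _) = fun w => f i w + \sum_(j <- s) f j w).
  exact: has_meanD.
by apply/funext => w; rewrite big_cons.
Qed.

(** Independence makes the law of the pair the product of the two laws. Tonelli then gives
    integrability of the product, and Fubini factors its integral. *)
Lemma independent_has_meanM {dU dV : measure_display} {U : measurableType dU}
    {V : measurableType dV} (X : {RV P >-> U}) (Y : {RV P >-> V})
    (f : U -> R) (g : V -> R) (a b : R) :
  measurable_fun setT f -> measurable_fun setT g ->
  independent_rvs X Y -> has_mean (f \o X) a -> has_mean (g \o Y) b ->
  has_mean (fun w => f (X w) * g (Y w)) (a * b).
Proof.
move=> mf mg XY [Xi XE] [Yi YE].
pose XY2 w := (X w, Y w).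
have mXY2 : measurable_fun [set: Omega] XY2.
  by apply: measurable_fun_pair; exact: measurable_funPT.
pose h (z : U * V) : \bar R := (f z.1 * g z.2)%:E.
have mh : measurable_fun setT h.
  by apply/measurable_EFinP; apply: measurable_funM; apply: measurableT_comp.
have mf' : measurable_fun setT (EFin \o f) by apply/measurable_EFinP.
have mg' : measurable_fun setT (EFin \o g) by apply/measurable_EFinP.
pose XYmf : {mfun Omega >-> (U * V)%type} :=
  HB.pack XY2 (isMeasurableFun.Build _ _ _ _ XY2 mXY2).
pose mu : {measure set _ -> \bar R} := distribution P XYmf.
(* [XY] says that the law of the pair agrees with the product law on measurable rectangles, and
   these determine the product measure. *)
have prodE A : measurable A -> (distribution P X \x distribution P Y)%E A = mu A.
  move=> mA; exact: product_measure_unique.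
have aXi : (distribution P X).-integrable setT (EFin \o f).
  by apply: integrable_pushforward.
have aYi : (distribution P Y).-integrable setT (EFin \o g).
  by apply: integrable_pushforward.
have hi : (distribution P X \x distribution P Y)%E.-integrable setT h.
  apply/integrable12ltyP => //=.
  (* The inner integral is |f(x)| times the finite constant E|g(Y)|, so the iterated integral is
     finite because f(X) is integrable. *)
  have -> : (fun x => \int[distribution P Y]_y `|h (x, y)|)%E =
      (fun x => (fine (\int[distribution P Y]_y `|(g y)%:E|))%:E * `|(f x)%:E|)%E.
    apply/funext => x; rewrite fineK; last first.
      by apply: integrable_fin_num => //; exact: integrable_abse aYi.
    rewrite muleC -ge0_integralZl//; last exact: measurableT_comp.
    by apply: eq_integral => y _; rewrite /h /= normrM EFinM.
  apply: integrable_lty => //; apply: integrableZl => //.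
  exact: integrable_abse aXi.
have EX : (\int[distribution P X]_x (f x)%:E = a%:E)%E.
  by rewrite -XE unlock; exact: (integral_distribution mf').
have EY : (\int[distribution P Y]_x (g x)%:E = b%:E)%E.
  by rewrite -YE unlock; exact: (integral_distribution mg').
(* A change of variables carries integrability from the product law back to [P]. *)
have hmu : P.-integrable setT (h \o XY2).
  apply/integrableP; split; first exact: measurableT_comp.
  have /integrableP[_] := hi; apply: le_lt_trans.
  rewrite (@eq_measure_integral _ _ _ setT mu); last first.
    by move=> A mA _; rewrite -(prodE A mA).
  by rewrite ge0_integral_pushforward//; exact: measurableT_comp.
split; first exact: hmu.
rewrite unlock.
transitivity (\int[mu]_z h z)%E; first by rewrite integral_pushforward.
rewrite (@eq_measure_integral _ _ _ setT
    (distribution P X \x distribution P Y)%E); last first.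
  by move=> A mA _; rewrite -(prodE A mA).
rewrite -integral12_prod_meas1//.
transitivity (\int[distribution P X]_x (b%:E * (f x)%:E))%E.
  apply: eq_integral => x _; rewrite /fubini_F /h /=.
  by under eq_integral do rewrite EFinM; rewrite integralZl// EY muleC.
by rewrite integralZl// EX muleC.
Qed.

(** This lets a mean given in advance be identified with one computed as a sum of probabilities. *)
Lemma has_mean_unique (f : Omega -> R) (a b : R) :
  has_mean f a -> has_mean f b -> a = b.
Proof. by move=> [_ fa] [_ fb]; move: fb; rewrite fa => -[]. Qed.

Lemma has_mean_bool (b : Omega -> bool) :
  measurable_fun setT b ->
  has_mean (fun w => (b w)%:R) (fine (P [set w | b w])).
Proof.
move=> mb.
have mB : measurable [set w | b w].
  rewrite (_ : mkset _ = b @^-1` [set true])// -[X in measurable X]setTI.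
  exact: mb.
rewrite (_ : (fun _ => _) = \1_[set w | b w]).
  by apply: has_mean_indic => //; rewrite fineK ?fin_num_measure.
apply/funext => w; rewrite indicE; congr (nat_of_bool _)%:R.
by apply/idP/idP; rewrite inE.
Qed.

(** A mean depends only on the law: both are integrals of [f] against the common distribution. This
    passes the moments of the first step to all steps. *)
Lemma identically_distributed_has_mean {dU : measure_display}
    {U : measurableType dU} {I : Type} (X : I -> {RV P >-> U})
    (f : U -> R) (i j : I) (a : R) :
  measurable_fun setT f -> identically_distributed P X ->
  has_mean (f \o X i) a -> has_mean (f \o X j) a.
Proof.
move=> mf XX [fi fE].
have mf' : measurable_fun setT (EFin \o f) by apply/measurable_EFinP.
have fi' : (distribution P (X i)).-integrable setT (EFin \o f).
  by apply: integrable_pushforward.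
have eqd A : measurable A -> A `<=` setT ->
    distribution P (X i) A = distribution P (X j) A.
  by move=> mA _; exact: XX.
have fj : P.-integrable setT ((EFin \o f) \o X j).
  apply/integrableP; split; first exact: measurableT_comp.
  have /integrableP[_] := fi'; apply: le_lt_trans.
  rewrite (eq_measure_integral _ eqd).
  by rewrite ge0_integral_pushforward//; exact: measurableT_comp.
split; first exact: fj.
move: fE; rewrite unlock => <-.
transitivity (\int[distribution P (X j)]_x (EFin \o f) x)%E.
  by rewrite integral_pushforward.
rewrite -(eq_measure_integral _ eqd).
by rewrite integral_pushforward.
Qed.

(** * Moments of counting variables and of random sums *)

Lemma has_mean_count (b : nat -> Omega -> bool) (t : nat) :
  (forall r, measurable_fun setT (b r)) ->
  has_mean (fun w => (\sum_(r < t) b r w)%N%:R)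
    (\sum_(r < t) fine (P [set w | b r w])).
Proof.
move=> mb; rewrite (_ : (fun _ => _) = fun w => \sum_(r < t) (b r w)%:R).
  by apply: has_mean_sum => r; exact: has_mean_bool.
by apply/funext => w; rewrite natr_sum.
Qed.

(** Expanding the square gives products of two indicators, each the indicator of a conjunction. No
    independence enters, so the result serves both for M as a count of trials and for M as a count
    of indices below it. *)
Lemma has_mean_count_sq (b : nat -> Omega -> bool) (t : nat) :
  (forall r, measurable_fun setT (b r)) ->
  has_mean (fun w => (\sum_(r < t) b r w)%N%:R ^+ 2)
    (\sum_(r < t) \sum_(s < t) fine (P [set w | b r w && b s w])).
Proof.
move=> mb; rewrite (_ : (fun _ => _) =
    fun w => \sum_(r < t) \sum_(s < t) (b r w && b s w)%:R).
  apply: has_mean_sum => r; apply: has_mean_sum => s.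
  by apply: has_mean_bool; exact: measurable_and.
apply/funext => w; rewrite natr_sum expr2 big_distrlr.
by do 2 (apply: eq_bigr => ? _ /=); rewrite -natrM mulnb.
Qed.

(* Expand the square as a double sum over r, s < t of [r, s < M] Y_r Y_s. *)
Lemma has_mean_random_sum_sq (Y : nat -> {RV P >-> R}) (M : {RV P >-> nat})
    (t : nat) (mu e2 m1 m2 : R) :
  (forall w, (M w <= t)%N) ->
  (forall r, has_mean (Y r) mu) ->
  (forall r, has_mean (fun w => Y r w ^+ 2) e2) ->
  (forall r s, r != s -> independent_rvs (Y r) (Y s)) ->
  (forall r s, independent_rvs M (Y r \* Y s)) ->
  has_mean (fun w => (M w)%:R) m1 ->
  has_mean (fun w => (M w)%:R ^+ 2) m2 ->
  has_mean (fun w => (\sum_(r < M w) Y r w) ^+ 2)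
    (mu ^+ 2 * m2 + (e2 - mu ^+ 2) * m1).
Proof.
move=> Mt Y1 Y2 YY MY M1 M2.
pose b r w := (r < M w)%N.
have mb r : measurable_fun setT (b r).
  by apply: (measurable_fun_ltn (measurable_cst r)); exact: measurable_funPT.
(* M counts the indices below it, so its first two moments are sums of the same numbers [g r s] that
   appear in the expanded square. *)
have bM w : (\sum_(r < t) b r w)%N = M w.
  rewrite -[RHS]card_ord -sum1_card (big_ord_widen t (fun=> 1%N) (Mt w)).
  by rewrite [RHS]big_mkcond; apply: eq_bigr => r _; rewrite /b; case: ifP.
pose g r s := fine (P [set w | b r w && b s w]).
have -> : m1 = \sum_(r < t) g r r.
  apply: has_mean_unique M1 _; under eq_fun do rewrite -bM.
  rewrite (eq_bigr (fun r : 'I_t => fine (P [set w | b r w]))).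
    exact: has_mean_count.
  move=> r _; rewrite /g; congr (fine (P _)).
  by apply/funext => w /=; rewrite andbb.
have -> : m2 = \sum_(r < t) \sum_(s < t) g r s.
  apply: has_mean_unique M2 _; under eq_fun do rewrite -bM.
  exact: has_mean_count_sq.
(* This is E(Y_r Y_s): the second moment on the diagonal, the squared mean off it. *)
pose c (r s : nat) := if r == s then e2 else mu ^+ 2.
rewrite (_ : (fun _ => _) = fun w => \sum_(r < t) \sum_(s < t)
    (b r w && b s w)%:R * (Y r w * Y s w)); last first.
  apply/funext => w; rewrite expr2 (big_ord_widen _ (fun r => Y r w) (Mt w)).
  rewrite big_mkcond big_distrlr; do 2 apply: eq_bigr => ? _.
  rewrite /= -/(b _ w) -/(b _ w).
  by case: (b _ w); case: (b _ w); rewrite /= ?mul0r ?mulr0 ?mul1r.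
rewrite (_ : _ + _ = \sum_(r < t) \sum_(s < t) g r s * c r s); last first.
  rewrite !mulr_sumr -big_split; apply: eq_bigr => r _ /=.
  (* Row r splits into its diagonal term, of weight e2, and the others, of weight mu^2. The excess
     e2 - mu^2 on the diagonal produces the [m1] term. *)
  rewrite (bigD1 r)//= [in RHS](bigD1 r)//= /c eqxx.
  rewrite [in RHS](eq_bigr (fun s : 'I_t => g r s * mu ^+ 2)); last first.
    move=> s sr; case: eqP => [rs|//].
    by rewrite (val_inj (esym rs) : s = r) eqxx in sr.
  by rewrite -mulr_suml; ring.
apply: has_mean_sum => r; apply: has_mean_sum => s.
have cE : has_mean (Y r \* Y s) (c r s).
  rewrite /c; have [<-|rs] := eqVneq (r : nat) s.
    have -> : Y r \* Y r = (fun w => Y r w ^+ 2) :> (Omega -> R).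
      by apply/funext => w /=; rewrite expr2.
    exact: Y2.
  rewrite expr2; apply: (independent_has_meanM (Y r) (Y s) id id) => //.
  - exact: YY.
  - exact: Y1.
  - exact: Y1.
(* The indicator of r, s < M is a function of M alone, hence independent of Y_r Y_s. *)
pose f k : R := ((r < k)%N && (s < k)%N)%:R.
have gE : has_mean (f \o M) (g r s).
  exact: (has_mean_bool _ (measurable_and (mb r) (mb s))).
apply: (independent_has_meanM M (Y r \* Y s) f id) => //.
exact: MY.
Qed.

End independence_facts.

(** * Moments of the stopped Bernoulli process *)

Section stopped_bernoulli.
Context {R : realType} {dO : measure_display} {Omega : measurableType dO}.

(** With it, membership of an event in a process sigma-algebra follows from the usual closure rules
    for measurable functions. *)
Lemma process_measurable_fun {dU : measure_display} {U : measurableType dU}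
    {I : Type} (X : I -> Omega -> U) (i : I) :
  measurable_fun
    (setT : set (g_sigma_algebraType
      (\bigcup_i preimage_set_system [set: Omega] (X i) measurable)))
    (X i).
Proof.
move=> _ B mB; apply: sub_sigma_algebra; exists i => //.
by exists B.
Qed.

(** The inequality is strict because index r denotes the (r+1)-st trial, which still counts when T =
    r+1. *)
Definition survives (o : option nat) (r : nat) : bool :=
  if o is Some s then (r < s)%N else true.

(** M(t) is N at the minimum of t and T, so it counts the successes whose index lies below both. *)
Lemma stopped_processE (N : nat -> Omega -> nat) (Z : nat -> Omega -> bool)
    (T : Omega -> option nat) (t : nat) (w : Omega) :
  (forall t w, N t w = (\sum_(r < t) Z r w)%N) ->
  stopped_process N T t w = (\sum_(r < t) (Z r w && survives (T w) r))%N.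
Proof.
move=> NE; rewrite /stopped_process /survives; case: (T w) => [s|]; last first.
  by rewrite NE; apply: eq_bigr => r _; rewrite andbT.
case: ltnP => [ts|st]; rewrite NE.
  by apply: eq_bigr => r _; rewrite (ltn_trans (ltn_ord r) ts) andbT.
rewrite (big_ord_widen t (fun r => Z r w : nat) st) big_mkcond.
by apply: eq_bigr => r _; case: (r < s)%N; rewrite ?andbT ?andbF.
Qed.

Context (P : probability Omega R).

(** Induction on r: survival at 0 is certain since T is never 0, and passing from r to r+1 removes
    the atom T = r+1. The formula persists because Q q^r - Q p q^r = Q q^(r+1) with q = 1 - p. *)
Lemma survives_prob (T : {RV P >-> option nat}) (p Q : R) :
  (forall w, T w <> Some 0%N) ->
  (forall t, (1 <= t)%N ->
    P (T @^-1` [set Some t]) = (Q * p * (1 - p) ^+ (t - 1))%:E) ->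
  forall r, P [set w | survives (T w) r] = (1 - Q + Q * (1 - p) ^+ r)%:E.
Proof.
move=> T0 TP; elim=> [|r IH].
  rewrite (_ : mkset _ = setT).
    by rewrite probability_setT expr0 mulr1 subrK.
  apply/seteqP; split => // w _ /=; have := T0 w.
  by rewrite /survives; case: (T w) => // -[].
have mT (A : set (option nat)) : measurable (T @^-1` A).
  by rewrite -[X in measurable X]setTI; apply: measurable_funPT.
have split_r : [set w | survives (T w) r] =
    [set w | survives (T w) r.+1] `|` T @^-1` [set Some r.+1].
  apply/seteqP; split => w /=; rewrite /survives; case: (T w) => [s|]//=.
  - by rewrite leq_eqVlt => /predU1P[<-|]; [right|left].
  - by left.
  - by case=> [/ltnW//|[->]].
have disj : [set w | survives (T w) r.+1] `&` T @^-1` [set Some r.+1] = set0.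
  by apply/seteqP; split => // w /= [] /[swap] -> /=; rewrite ltnn.
have mS := mT [set o | survives o r.+1].
have := IH; rewrite split_r measureU//.
rewrite [X in (_ + X)%E = _](TP r.+1 isT) subn1 /= => h.
have fin : P [set w | survives (T w) r.+1] \is a fin_num.
  exact: fin_num_measure.
move: h; rewrite -(fineK fin) -EFinD => -[h]; congr EFin.
by rewrite exprS; lra.
Qed.

Context (N : nat -> Omega -> nat) (Z : nat -> {RV P >-> bool})
  (T : {RV P >-> option nat}).
Context (NE : forall t w, N t w = (\sum_(r < t) Z r w)%N).

Let b r w := Z r w && survives (T w) r.

Let mb r : measurable_fun setT (b r).
Proof.
have mS : measurable_fun setT (survives^~ r) by [].
exact: (measurable_and (measurable_funPT (Z r))
  (measurableT_comp mS (measurable_funPT T))).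
Qed.

Lemma stopped_process_measurable t :
  measurable_fun setT (stopped_process N T t).
Proof.
rewrite (_ : stopped_process N T t = fun w => (\sum_(r < t) b r w)%N); last first.
  by apply/funext => w; exact: (stopped_processE N (fun r => Z r) T t w NE).
elim: t => [|t IH].
  by under eq_fun do rewrite big_ord0; exact: measurable_cst.
under eq_fun do rewrite big_ord_recr.
apply: measurable_fun_addn => //.
have mB : measurable_fun setT nat_of_bool by [].
exact: (measurableT_comp mB (mb t)).
Qed.

Lemma stopped_process_le t w : (stopped_process N T t w <= t)%N.
Proof.
rewrite (stopped_processE N (fun r => Z r) T t w NE) -[leqRHS]card_ord -sum1_card.
by apply: leq_sum => r _; exact: leq_b1.
Qed.

Context (p0 : R) (h : nat -> R).
Context (Z_iid : iid Z).
Context (Z_p0 : forall r, P (Z r @^-1` [set true]) = p0%:E).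
Context (NT : independent_processes P N
  (fun _ : unit => (T : Omega -> option nat))).
Context (survivesE : forall r, P [set w | survives (T w) r] = (h r)%:E).

(* The r-th trial counts iff it succeeds and T has not occurred by then, so two
   counted trials require survival up to the later one. *)
Let bbE r s : fine (P [set w | b r w && b s w]) =
  (if r == s then p0 else p0 ^+ 2) * h (maxn r s).
Proof.
have -> : [set w | b r w && b s w] =
    [set w | Z r w && Z s w] `&` [set w | survives (T w) (maxn r s)].
  apply/seteqP; split => w /=; rewrite /b.
    move=> /andP[/andP[-> rT] /andP[-> sT]]; split => //.
    by rewrite /maxn; case: ifP.
  move=> [/andP[-> ->]] /=.
  by rewrite /survives; case: (T w) => // k; rewrite gtn_max.
(* [NT] concerns N rather than its trials, so the event that trials r and s succeed has to be placed
   in the sigma-algebra of N. *)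
rewrite NT; first last.
- have := @process_measurable_fun _ _ _
    (fun _ : unit => (T : Omega -> option nat)) tt.
  move=> /(_ measurableT [set o | survives o (maxn r s)]).
  by rewrite setTI; apply.
- have mN i := process_measurable_fun N i.
  have mF := measurable_and (measurable_fun_ltn (mN r) (mN r.+1))
    (measurable_fun_ltn (mN s) (mN s.+1)).
  have := mF measurableT [set true] I; rewrite setTI.
  set A := (X in measurable X); set B := (X in process_sigma_algebra _ X).
  suff -> : B = A by [].
  (* the trials are recovered as the jumps of the counting process N *)
  have NZ i w : (N i w < N i.+1 w)%N = Z i w.
    by rewrite !NE big_ord_recr /= -[X in (X < _)%N]addn0 ltn_add2l lt0b.
  by apply/seteqP; split => w; rewrite /A /B /= !NZ.
rewrite survivesE.
suff -> : P [set w | Z r w && Z s w] = (if r == s then p0 else p0 ^+ 2)%:E.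
  by [].
have [<-|rs] := eqVneq r s.
  rewrite -(Z_p0 r); congr (P _).
  by apply/funext => w /=; rewrite andbb.
have [indZ _] := Z_iid.
rewrite expr2 EFinM -{1}(Z_p0 r) -(Z_p0 s).
rewrite -(mutually_independent_pair _ _ _ _ indZ rs)//.
by congr (P _); apply/seteqP; split => w /=; [move=> /andP|move=> [-> ->]].
Qed.

Lemma stopped_process_mean t :
  has_mean P (fun w => (stopped_process N T t w)%:R)
    (p0 * \sum_(r < t) h r).
Proof.
under eq_fun do rewrite (stopped_processE N (fun r => Z r) T t _ NE).
rewrite mulr_sumr.
rewrite (eq_bigr (fun r : 'I_t => fine (P [set w | b r w]))).
  exact: has_mean_count.
move=> r _; have := bbE r r; rewrite eqxx maxnn => <-.
by congr (fine (P _)); apply/funext => w /=; rewrite andbb.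
Qed.

Lemma stopped_process_mean_sq t :
  has_mean P (fun w => (stopped_process N T t w)%:R ^+ 2)
    (p0 ^+ 2 * (\sum_(r < t) \sum_(s < t) h (maxn r s)) +
     (p0 - p0 ^+ 2) * \sum_(r < t) h r).
Proof.
under eq_fun do rewrite (stopped_processE N (fun r => Z r) T t _ NE).
rewrite (_ : _ + _ = \sum_(r < t) \sum_(s < t) fine (P [set w | b r w && b s w])).
  exact: has_mean_count_sq.
rewrite !mulr_sumr -big_split; apply: eq_bigr => r _ /=.
(* The diagonal weight p0 is split as p0^2 + (p0 - p0^2), which completes row r of the double
   sum. *)
rewrite (bigD1 r)//= [in RHS](bigD1 r)//= bbE eqxx maxnn.
rewrite [in RHS](eq_bigr (fun s : 'I_t => p0 ^+ 2 * h (maxn r s))); last first.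
  move=> s sr; rewrite bbE; case: eqP => [rs|//].
  by rewrite (val_inj (esym rs) : s = r) eqxx in sr.
by rewrite -mulr_sumr; ring.
Qed.

End stopped_bernoulli.

(** * Limits of averaged survival probabilities *)

Section survival_averages.
Context {R : realType} (Lambda Q q : R).
Context (q_01 : 0 < q < 1).
Context (Q_ge0 : 0 <= Q).

Let h r := Lambda + Q * q ^+ r.

Lemma average_survival_cvg :
  t%:R^-1 * (\sum_(r < t) h r) @[t --> \oo] --> Lambda.
Proof.
(* The Cesaro mean of index n averages the first n+1 terms, hence the shift. *)
rewrite -cvg_shiftS; case/andP: q_01 => q_gt0 q_lt1.
have hL : h @ \oo --> Lambda.
  rewrite -[X in _ --> X]addr0 -(mulr0 Q); apply: cvgD; first exact: cvg_cst.
  apply: cvgM; first exact: cvg_cst.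
  by apply: cvg_expr; rewrite ger0_norm// ltW.
have := cesaro hL; rewrite /arithmetic_mean /series /=.
by under eq_fun do rewrite big_mkord.
Qed.

Lemma average_survival_max_cvg :
  (t%:R ^+ 2)^-1 * (\sum_(r < t) \sum_(s < t) h (maxn r s)) @[t --> \oo]
    --> Lambda.
Proof.
case/andP: q_01 => q_gt0 q_lt1.
have q0 n : 0 <= q ^+ n by rewrite exprn_ge0// ltW.
apply: (squeeze_cvgr (f := fun=> Lambda)
    (h := fun t => t%:R^-1 * (\sum_(r < t) h r))); last 2 first.
- exact: cvg_cst.
- exact: average_survival_cvg.
near=> t.
(* At t = 0 the inverse is 0 by convention and the lower bound fails for positive Lambda. *)
have t0 : 0 < t%:R :> R by rewrite ltr0n; near: t; exact: nbhs_infty_gt.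
apply/andP; split.
  rewrite mulrC ler_pdivlMr ?exprn_gt0//.
  rewrite (_ : _ * _ = \sum_(r < t) \sum_(s < t) Lambda).
    by do 2 apply: ler_sum => ? _; rewrite /h lerDl mulr_ge0.
  by rewrite !sumr_const !card_ord -mulrnA -[RHS]mulr_natr natrM expr2.
rewrite mulrC ler_pdivrMr ?exprn_gt0//.
(* Powers of q decrease, so max(r, s) may be replaced by r. The summand then no longer depends on s,
   and the double average collapses to the single one. *)
rewrite (_ : _ * _ = \sum_(r < t) \sum_(s < t) h r).
  do 2 apply: ler_sum => ? _; rewrite /h lerD2l ler_wpM2l//.
  by apply: ler_wiXn2l; rewrite ?leq_maxl// ltW.
rewrite [in RHS](eq_bigr (fun r : 'I_t => h r * t%:R)); last first.
  by move=> r _; rewrite sumr_const card_ord mulr_natr.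
by rewrite -mulr_suml; field; rewrite gt_eqF.
Unshelve. all: by end_near. Qed.

End survival_averages.

(** * Second moments of the walk and their asymptotics *)

Lemma cvg_near_eq {T : topologicalType} (f g : nat -> T) (l : T) :
  (\forall t \near \oo, f t = g t) -> f @ \oo --> l -> g @ \oo --> l.
Proof. by move=> fg; apply: cvg_trans; exact: near_eq_cvg. Qed.

Theorem mainTheorem5 (R : realType) (dO : measure_display)
    (Omega : measurableType dO) (P : probability Omega R)
    (p0 p q QS LambdaM : R)
    (p0_01 : 0 < p0 < 1) (p_01 : 0 < p < 1) (qE : q = 1 - p)
    (QS_01 : 0 < QS < 1) (LambdaME : LambdaM = 1 - QS)
    (NII : nat -> Omega -> nat)
    (NII_bernoulli : bernoulli_process P p0 NII)
    (DT : {RV P >-> option nat})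
    (DT_pos : forall w, DT w <> Some 0%N)
    (DT_fin : forall t, (1 <= t)%N ->
      P (DT @^-1` [set Some t]) = (QS * p * q ^+ (t - 1))%:E)
    (DT_inf : P (DT @^-1` [set None]) = (1 - QS)%:E)
    (NII_DT_indep :
      independent_processes P NII (fun _ : unit => (DT : Omega -> option nat)))
    (d : nat) (xi : nat -> {RV P >-> 'rV[int]_d})
    (xi_iid : iid xi)
    (xi_M_indep : independent_processes P xi (stopped_process NII DT))
    (xi_moment1 : forall j : 'I_d,
      P.-integrable [set: Omega] (fun w => (component (xi 0%N) j w)%:E))
    (xi_moment2 : forall j : 'I_d,
      P.-integrable [set: Omega] (fun w => (component (xi 0%N) j w ^+ 2)%:E)) :
  let X := walk xi (stopped_process NII DT) in
  let Exi (j : 'I_d) : \bar R := 'E_P[component (xi 0%N) j]%E in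
  let Exi2 (j : 'I_d) : \bar R :=
    'E_P[(fun w => component (xi 0%N) j w ^+ 2)%R]%E in
  ((forall j, Exi j = 0%E) ->
     ((t%:R^-1)%:E *
        'E_P[(fun w => \sum_(j < d) component (X t) j w ^+ 2)%R])%E @[t --> \oo] -->
     (LambdaM%:E * p0%:E * \sum_(j < d) Exi2 j)%E)
  /\
  (forall j, Exi j <> 0%E ->
     asymp_equiv (fun t => 'E_P[(fun w => component (X t) j w ^+ 2)%R]%E)
       (fun t => (LambdaM%:E * p0%:E ^+ 2 * Exi j ^+ 2 * (t%:R)%:E ^+ 2)%E)).
Proof.
move=> X Exi Exi2.
have [/andP[p0_gt0 p0_lt1] /andP[p_gt0 p_lt1]] := (p0_01, p_01).
have /andP[QS_gt0 QS_lt1] := QS_01.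
have [Z [Z_iid Z_p0 NE]] := NII_bernoulli.
pose M := stopped_process NII DT.
pose h r := LambdaM + QS * q ^+ r.
have q_01 : 0 < q < 1 by rewrite qE; apply/andP; split; lra.
have survE r : P [set w | survives (DT w) r] = (h r)%:E.
  rewrite /h LambdaME qE; apply: survives_prob => // s s1.
  by rewrite DT_fin// qE.
pose m1 t := p0 * \sum_(r < t) h r.
pose m2 t := p0 ^+ 2 * (\sum_(r < t) \sum_(s < t) h (maxn r s)) +
  (p0 - p0 ^+ 2) * \sum_(r < t) h r.
have M1 t : has_mean P (fun w => (M t w)%:R) (m1 t).
  exact: (stopped_process_mean P NII Z DT).
have M2 t : has_mean P (fun w => (M t w)%:R ^+ 2) (m2 t).
  exact: (stopped_process_mean_sq P NII Z DT).
(* Integrability makes both moments finite, so the computation can take place in [R]. *)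
pose mu j := fine (Exi j).
pose e2 j := fine (Exi2 j).
have ExiE j : Exi j = (mu j)%:E.
  by rewrite fineK// /Exi unlock; exact: integrable_fin_num.
have Exi2E j : Exi2 j = (e2 j)%:E.
  by rewrite fineK// /Exi2 unlock; exact: integrable_fin_num.
pose F j t := mu j ^+ 2 * m2 t + (e2 j - mu j ^+ 2) * m1 t.
have X2 j t : has_mean P (fun w => component (X t) j w ^+ 2) (F j t).
  pose f (v : 'rV[int]_d) : R := (v ord0 j)%:~R.
  have mf : measurable_fun setT f by [].
  have mM : measurable_fun setT (M t).
    exact: (stopped_process_measurable P NII Z DT).
  pose M' : {RV P >-> nat} :=
    HB.pack (M t) (isMeasurableFun.Build _ _ _ _ (M t) mM).
  have mY r : measurable_fun setT (f \o xi r).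
    exact: (measurableT_comp mf (measurable_funPT (xi r))).
  pose Y r : {RV P >-> R} :=
    HB.pack (f \o xi r) (isMeasurableFun.Build _ _ _ _ (f \o xi r) (mY r)).
  have [xi_ind xi_id] := xi_iid.
  have -> : (fun w => component (X t) j w ^+ 2) =
      fun w => (\sum_(r < M' w) Y r w) ^+ 2.
    apply/funext => w; congr (_ ^+ 2).
    by rewrite /component /X /walk summxE rmorph_sum.
  have mf2 : measurable_fun setT (fun v => f v ^+ 2) by [].
  apply: (has_mean_random_sum_sq P Y M' t) => [w|r|r|r s rs|r s||].
  - exact: (stopped_process_le P NII Z DT).
  - apply: (identically_distributed_has_mean P xi f 0%N r (mu j) mf xi_id).
    by split; [exact: xi_moment1|rewrite -ExiE].
  - apply: (identically_distributed_has_mean P xi _ 0%N r (e2 j) mf2 xi_id).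
    by split; [exact: xi_moment2|rewrite -Exi2E].
  - apply: (independent_rvs_comp P (xi r) (xi s) f f) => //.
    exact: (mutually_independent_pair P (fun i => xi i) r s).
  (* M(t) is independent of the steps as a whole family, and Y_r Y_s is measurable for the
     sigma-algebra that family generates. *)
  - move=> A B mA mB; rewrite setIC muleC; apply: xi_M_indep.
      have mxi i := measurableT_comp mf (process_measurable_fun xi i).
      have mxirs := measurable_funM (mxi r) (mxi s).
      by have := mxirs measurableT B mB; rewrite setTI.
    have mMt := process_measurable_fun (stopped_process NII DT) t.
    by have := mMt measurableT A mA; rewrite setTI.
  - exact: M1.
  - exact: M2.
have tN0 : \forall t \near \oo, t%:R != 0 :> R.
  by near=> t; rewrite pnatr_eq0 -lt0n; near: t; exact: nbhs_infty_gt.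
have a_cvg : t%:R^-1 * (\sum_(r < t) h r) @[t --> \oo] --> LambdaM.
  by apply: average_survival_cvg => //; lra.
have b_cvg : (t%:R ^+ 2)^-1 * (\sum_(r < t) \sum_(s < t) h (maxn r s))
    @[t --> \oo] --> LambdaM.
  by apply: average_survival_max_cvg => //; lra.
split => [Exi0|j Exi_neq0].
  have mu0 j : mu j = 0 by rewrite /mu Exi0.
  have EX t : ('E_P[(fun w => \sum_(j < d) component (X t) j w ^+ 2)%R] =
      (\sum_(j < d) F j t)%:E)%E.
    by have [] := has_mean_sum P (index_enum 'I_d) _ _ (X2^~ t).
  under eq_fun do rewrite EX -EFinM.
  rewrite (eq_bigr (fun j => (e2 j)%:E)); last by move=> j _; exact: Exi2E.
  rewrite sumEFin -!EFinM; apply/fine_cvgP; split; first by near=> t.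
  rewrite (_ : fine \o _ = fun t =>
      (t%:R^-1 * \sum_(r < t) h r) * (p0 * \sum_(j < d) e2 j)).
    by rewrite -mulrA; apply: cvgM => //; exact: cvg_cst.
  apply/funext => t /=.
  (* With zero means, F j t reduces to e2_j E M(t), and only the single average of h remains. *)
  under eq_bigr do rewrite /F mu0 expr0n /= mul0r add0r subr0.
  by rewrite -mulr_suml /m1; ring.
have mu_neq0 : mu j != 0.
  by apply/eqP => mu0; apply: Exi_neq0; rewrite ExiE mu0.
have L_neq0 : LambdaM != 0 by rewrite gt_eqF//; lra.
have p0_neq0 : p0 != 0 by rewrite gt_eqF//; lra.
(* This is F j t over the claimed equivalent, with t^2 distributed so that both convergent averages
   appear. The single sum keeps a spare factor 1/t, which makes its contribution vanish. *)
pose G t := (LambdaM * p0 ^+ 2 * mu j ^+ 2)^-1 *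
  (mu j ^+ 2 * (p0 ^+ 2 *
     ((t%:R ^+ 2)^-1 * (\sum_(r < t) \sum_(s < t) h (maxn r s)))) +
   (mu j ^+ 2 * (p0 - p0 ^+ 2) + (e2 j - mu j ^+ 2) * p0) *
     (t%:R^-1 * (t%:R^-1 * \sum_(r < t) h r))).
have G_cvg : G t @[t --> \oo] --> (1 : R).
  (* The limit 1 is written in the shape of [G], with 0 for the limit of 1/t, so that the limit
     rules apply termwise. *)
  rewrite [X in _ --> X](_ : _ = (LambdaM * p0 ^+ 2 * mu j ^+ 2)^-1 *
    (mu j ^+ 2 * (p0 ^+ 2 * LambdaM) +
     (mu j ^+ 2 * (p0 - p0 ^+ 2) + (e2 j - mu j ^+ 2) * p0) *
       (0 * LambdaM))); last first.
    by field; rewrite mu_neq0 L_neq0 p0_neq0.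
  have inv_cvg : t%:R^-1 @[t --> \oo] --> (0 : R).
    by rewrite -cvg_shiftS; exact: cvg_harmonic.
  apply: cvgM; first exact: cvg_cst.
  apply: cvgD; apply: cvgM; try exact: cvg_cst.
    by apply: cvgM => //; exact: cvg_cst.
  exact: cvgM.
(* The extended quotient is identified with [G] only for nonzero t, where its denominator is nonzero
   and the extended inverse is the real one. *)
apply: (cvg_near_eq (fun t => (G t)%:E)); last by apply/cvg_EFin => //; near=> t.
near=> t.
have t0 : t%:R != 0 :> R by near: t.
have [_ ->] := X2 j t.
rewrite ExiE -!EFin_expe -!EFinM inver ifN; last first.
  by rewrite !mulf_neq0 ?expf_neq0.
rewrite -EFinM; congr EFin; rewrite /G /F /m1 /m2; field.
by rewrite t0 mu_neq0 L_neq0 p0_neq0.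
Unshelve. all: by end_near. Qed.
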